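(* Let $M_1,\ldots,M_n$ be smooth manifolds (each finite-dimensional, or an infinite-dimensional Banach manifold), let $M=M_1\times\cdots\times M_n$, and let $f_1,\ldots,f_n\in C^2(M,\mathbb{R})$ be the players' cost functions, with associated differential game form $\omega$. If $u=(u_1,\ldots,u_n)\in M$ is a local Nash equilibrium of the game $(f_1,\ldots,f_n)$, then $\omega(u)=0$ and $D_{ii}^2f_i(u)$ is positive semi-definite for each $i\in\{1,\ldots,n\}$.
   Context: Game: there are $n$ players; player $i$ chooses a strategy $u_i\in M_i$ and wants to minimize $f_i$. Each $M_i$ is a second-countable Hausdorff smooth manifold modeled on a Banach space $E_i$ (finite- or infinite-dimensional). Charts on $M$ are taken to be product charts $(U,\varphi)$ with $U=U_1\times\cdots\times U_n$, $\varphi=\varphi_1\times\cdots\times\varphi_n$, where $(U_i,\varphi_i)$ is a chart on $M_i$. Local Nash equilibrium: $(u_1,\ldots,u_n)\in M$ is a local Nash equilibrium if there exist open sets $W_i\subset M_i$ with $u_i\in W_i$ such that for each $i$, $f_i(u_1,\ldots,u_i,\ldots,u_n)\le f_i(u_1,\ldots,u_i',\ldots,u_n)$ for all $u_i'\in W_i\setminus\{u_i\}$ (only the $i$-th coordinate is changed). Partial derivatives: $D_if_j(u)\in T^*_{u_i}M_i$ is the derivative at $u_i$ of the map $\mu_i\mapsto f_j(u_1,\ldots,u_{i-1},\mu_i,u_{i+1},\ldots,u_n)$ on $M_i$. Differential game form: $\omega=\sum_{i=1}^n\psi_{M_i}\circ df_i:M\to T^*M$, where, under the canonical splitting $T^*_{u}M\cong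 T^*_{u_1}M_1\oplus\cdots\oplus T^*_{u_n}M_n$, the bundle map $\psi_{M_i}$ sends $(\omega_1,\ldots,\omega_n)$ to $(0,\ldots,0,\omega_i,0,\ldots,0)$. Thus $\omega(u)=(D_1f_1(u),\ldots,D_nf_n(u))$. Second-order conditions: when $D_if_i(u)=0$, $D_{ii}^2f_i(u)=D_i(D_if_i)(u)$ is the Hessian at the critical point $u_i$ of $\mu_i\mapsto f_i(u_1,\ldots,\mu_i,\ldots,u_n)$, a continuous symmetric bilinear form on $T_{u_i}M_i$, computed in a chart as $D_{ii}^2(f_i\circ\varphi^{-1})(\varphi(u))$. It is called positive semi-definite if there is $\alpha\ge 0$ such that, in a chart, $D_{ii}^2(f_i\circ\varphi^{-1})(\varphi(u))(\nu,\nu)\ge\alpha\|\nu\|^2$ for all $\nu\in E_i$ (this property does not depend on the chart). *)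

(* Defs.v *)
From HB Require Import structures.
From mathcomp Require Import all_boot all_order all_algebra.
From mathcomp Require Import mathcomp_extra boolp classical_sets functions reals.
From mathcomp Require Import topology normedtype landau derive.

Set Implicit Arguments.
Unset Strict Implicit.
Unset Printing Implicit Defensive.
Import Order.TTheory GRing.Theory Num.Theory.
Import numFieldNormedType.Exports.
Local Open Scope classical_set_scope.
Local Open Scope ring_scope.

Section ContinuousLinear.
Context {R : realType} (V W : normedModType R).

Definition clin_pred : {pred V -> W} :=
  [pred f : V -> W | `[< linear f /\ continuous f >]].

Lemma clin_submod_closed : submod_closed clin_pred.
Proof.
split=> [|a f g]; rewrite !inE.
  by split=> [b x y|]; [rewrite scaler0 addr0|exact: cst_continuous].
move=> [lf cf] [lg cg]; split=> [b x y|x].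
  change (a *: f (b *: x + y) + g (b *: x + y) =
          b *: (a *: f x + g x) + (a *: f y + g y)).
  by rewrite lf lg !scalerDr !scalerA [b * a]mulrC addrACA.
change (continuous_at x (fun x => a *: f x + g x)).
by apply: cvgD; [apply: cvgZl_tmp; exact: cf|exact: cg].
Qed.

HB.instance Definition _ := GRing.isSubmodClosed.Build R (V -> W) clin_pred
  clin_submod_closed.

Record clin := Clin { clin_fun :> V -> W; clinP : clin_fun \in clin_pred }.

HB.instance Definition _ := [isSub for clin_fun].
HB.instance Definition _ := [Choice of clin by <:].
HB.instance Definition _ := [SubChoice_isSubLmodule of clin by <:].

Implicit Types f g : clin.

Lemma clin_linear f : linear f.
Proof. by have := clinP f; rewrite !inE => -[]. Qed.

Lemma clin_continuous f : continuous f.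
Proof. by have := clinP f; rewrite !inE => -[]. Qed.

HB.instance Definition _ f :=
  GRing.isLinear.Build R V W *:%R (clin_fun f) (clin_linear f).

Lemma clinE f g : (forall x, f x = g x) -> f = g.
Proof. by move=> fg; apply/val_inj/funext. Qed.

Definition op_norm f : R := sup [set `|f x| | x in [set x | `|x| <= 1]].

Let op_has_sup f : has_sup [set `|f x| | x in [set x : V | `|x| <= 1]].
Proof.
split; first by exists `|f 0|, 0 => //=; rewrite normr0.
have /linear_bounded_continuous/bounded_funP/(_ 1)[M fM] := @clin_continuous f.
by exists M => _ [x /= x1 <-]; exact: fM.
Qed.

Lemma op_norm_ge0 f : 0 <= op_norm f.
Proof.
apply: le_trans (normr_ge0 (f 0)) _; apply: sup_upper_bound => //.
by exists 0 => //=; rewrite normr0.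
Qed.

Lemma le_op_norm f x : `|f x| <= op_norm f * `|x|.
Proof.
have [->|x0] := eqVneq x 0; first by rewrite linear0 !normr0 mulr0.
rewrite -ler_pdivrMr ?normr_gt0//.
have -> : `|f x| / `|x| = `|f (`|x|^-1 *: x)|.
  by rewrite linearZ /= normrZ normfV normr_id mulrC.
apply: sup_upper_bound => //; exists (`|x|^-1 *: x) => //=.
by rewrite normrZ normfV normr_id mulVf ?normr_eq0.
Qed.

Lemma op_norm_le f (C : R) : 0 <= C -> (forall x, `|f x| <= C * `|x|) ->
  op_norm f <= C.
Proof.
move=> C0 fC; apply: ge_sup; first by case: (op_has_sup f).
move=> _ [x /= x1 <-]; apply: le_trans (fC x) _.
by rewrite -[leRHS]mulr1 ler_wpM2l.
Qed.

Let op_normD f g : op_norm (f + g) <= op_norm f + op_norm g.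
Proof.
apply: op_norm_le => [|x]; first by rewrite addr_ge0 ?op_norm_ge0.
by rewrite mulrDl (le_trans (ler_normD _ _))// lerD// le_op_norm.
Qed.

Let op_normZ (a : R) f : op_norm (a *: f) = `|a| * op_norm f.
Proof.
have le1 (b : R) g : op_norm (b *: g) <= `|b| * op_norm g.
  apply: op_norm_le => [|x]; first by rewrite mulr_ge0 ?op_norm_ge0.
  by rewrite -mulrA -[leLHS]/(`|b *: g x|) normrZ ler_wpM2l ?le_op_norm.
apply/eqP; rewrite eq_le le1 /=.
have [->|a0] := eqVneq a 0; first by rewrite normr0 mul0r op_norm_ge0.
rewrite -ler_pdivlMl ?normr_gt0// -normfV.
by apply: le_trans (le1 _ _); rewrite scalerA mulVf// scale1r.
Qed.

Let op_norm0_eq0 f : op_norm f = 0 -> f = 0.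
Proof.
move=> f0; apply: clinE => x.
by have := le_op_norm f x; rewrite f0 mul0r normr_le0 => /eqP.
Qed.

HB.instance Definition _ :=
  Lmodule_isNormed.Build R clin op_normD op_normZ op_norm0_eq0.

End ContinuousLinear.

Arguments clin_pred {R} V W.

Section ContinuousLinearBuild.
Context {R : realType} {U V W : normedModType R}.

Lemma clin_bounded_subproof (f : V -> W) (C : R) :
  linear f -> (forall x, `|f x| <= C * `|x|) -> f \in clin_pred V W.
Proof.
move=> lf fC; rewrite !inE; split=> //.
pose L := GRing.isLinear.Build R V W *:%R f lf.
pose F : {linear V -> W} := HB.pack f L.
apply: (@bounded_linear_continuous R V W F); apply/bounded_funP => r.
exists (`|C| * r) => x xr; apply: le_trans (fC x) _.
apply: le_trans (_ : `|C| * `|x| <= _); last by rewrite ler_wpM2l.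
by rewrite ler_wpM2r// ler_norm.
Qed.

Definition clin_bounded (f : V -> W) (C : R) (lf : linear f)
    (fC : forall x, `|f x| <= C * `|x|) : clin V W :=
  Clin (clin_bounded_subproof lf fC).

Lemma clin_comp_subproof (g : clin V W) (f : clin U V) :
  g \o f \in clin_pred U W.
Proof.
rewrite !inE; split=> [a x y|x]; first by rewrite /= !linearP.
by apply: continuous_comp; exact: clin_continuous.
Qed.

Definition clin_comp (g : clin V W) (f : clin U V) : clin U W :=
  Clin (clin_comp_subproof g f).

Lemma diff_clin_subproof (f : V -> W) (x : V) :
  ('d f x : V -> W) \in clin_pred V W.
Proof.
rewrite !inE; split; first exact: linearP.
rewrite /diff; case: xgetP => [df _ []//|_].
exact: cst_continuous.
Qed.

(* 'd f x is the zero map when f is not differentiable at x. *)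
Definition fdiff (f : V -> W) (x : V) : clin V W := Clin (diff_clin_subproof f x).

End ContinuousLinearBuild.

Definition bprod {R : realType} {I : finType} (E : I -> normedModType R) : Type :=
  forall i, E i.

Section NormedProduct.
Context {R : realType} {I : finType} (E : I -> normedModType R).
Local Notation P := (bprod E).
Implicit Types v w : P.

HB.instance Definition _ := gen_eqMixin P.
HB.instance Definition _ := gen_choiceMixin P.

Lemma bprodP v w : (forall i, v i = w i) -> v = w.
Proof. exact: functional_extensionality_dep. Qed.

Let add v w : P := fun i => v i + w i.
Let opp v : P := fun i => - v i.
Let zero : P := fun i => 0.
Let scale (a : R) v : P := fun i => a *: v i.

Let addA : associative add.
Proof. by move=> u v w; apply: bprodP => i; exact: addrA. Qed.
Let addC : commutative add.
Proof. by move=> u v; apply: bprodP => i; exact: addrC. Qed.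
Let add0 : left_id zero add.
Proof. by move=> u; apply: bprodP => i; exact: add0r. Qed.
Let addN : left_inverse zero opp add.
Proof. by move=> u; apply: bprodP => i; exact: addNr. Qed.

HB.instance Definition _ := GRing.isZmodule.Build P addA addC add0 addN.

Let scaleA (a b : R) v : scale a (scale b v) = scale (a * b) v.
Proof. by apply: bprodP => i; exact: scalerA. Qed.
Let scale1 : left_id 1 scale.
Proof. by move=> u; apply: bprodP => i; exact: scale1r. Qed.
Let scaleD : right_distributive scale +%R.
Proof. by move=> a u v; apply: bprodP => i; exact: scalerDr. Qed.
Let scaleDl v : {morph scale^~ v : a b / a + b}.
Proof. by move=> a b; apply: bprodP => i; exact: scalerDl. Qed.

HB.instance Definition _ :=
  GRing.Zmodule_isLmodule.Build R P scaleA scale1 scaleD scaleDl.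

Definition bprod_norm v : R := \big[Num.max/0]_i `|v i|.

Lemma le_bprod_norm v i : `|v i| <= bprod_norm v.
Proof. exact: (le_bigmax 0 (fun i => `|v i|)). Qed.

Lemma bprod_norm_le v (C : R) :
  0 <= C -> (forall i, `|v i| <= C) -> bprod_norm v <= C.
Proof. by move=> C0 vC; apply/bigmax_leP; split. Qed.

Let norm_ge0 v : 0 <= bprod_norm v.
Proof. exact: bigmax_ge_id. Qed.

Let normD v w : bprod_norm (v + w) <= bprod_norm v + bprod_norm w.
Proof.
apply: bprod_norm_le => [|i]; first by rewrite addr_ge0.
by rewrite (le_trans (ler_normD _ _))// lerD// le_bprod_norm.
Qed.

Let normZ (a : R) v : bprod_norm (a *: v) = `|a| * bprod_norm v.
Proof.
have le1 (b : R) w : bprod_norm (b *: w) <= `|b| * bprod_norm w.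
  apply: bprod_norm_le => [|i]; first by rewrite mulr_ge0.
  by rewrite -[leLHS]/(`|b *: w i|) normrZ ler_wpM2l// le_bprod_norm.
apply/eqP; rewrite eq_le le1 /=.
have [->|a0] := eqVneq a 0; first by rewrite normr0 mul0r.
rewrite -ler_pdivlMl ?normr_gt0// -normfV.
by apply: le_trans (le1 _ _); rewrite scalerA mulVf// scale1r.
Qed.

Let norm0_eq0 v : bprod_norm v = 0 -> v = 0.
Proof.
move=> v0; apply: bprodP => i.
by have := le_bprod_norm v i; rewrite v0 normr_le0 => /eqP.
Qed.

HB.instance Definition _ := Lmodule_isNormed.Build R P normD normZ norm0_eq0.

Lemma bprod_cvg (T : Type) (F : set_system T) (f : T -> P) (l : P) :
  Filter F -> (forall i, (fun x => f x i) @ F --> l i) -> f @ F --> l.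
Proof.
move=> FF fl; apply/cvgrPdist_le => e e0.
have : \forall x \near F, forall i, `|l i - f x i| <= e.
  by apply: filter_forall => i; move/cvgrPdist_le : (fl i); exact.
apply: filterS => x fx.
by apply: bprod_norm_le => //; exact: ltW.
Qed.

Let proj_linear i : linear (fun v => v i). Proof. by []. Qed.
Let proj_bounded i v : `|v i| <= 1 * `|v|.
Proof. by rewrite mul1r; exact: le_bprod_norm. Qed.

Definition bproj i : clin P (E i) :=
  clin_bounded (@proj_linear i) (@proj_bounded i).

Let axis_linear i : linear (fun v : P => dfwith (0 : P) i (v i) : P).
Proof.
move=> a v w; apply: bprodP => j.
have [<-|ij] := eqVneq i j.
  change (dfwith (0 : P) i ((a *: v + w) i) i =
    a *: dfwith (0 : P) i (v i) i + dfwith (0 : P) i (w i) i).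
  by rewrite !dfwithin.
change (dfwith (0 : P) i ((a *: v + w) i) j =
  a *: dfwith (0 : P) i (v i) j + dfwith (0 : P) i (w i) j).
by rewrite !dfwithout// [X in _ = a *: X + _]/= [(0 : P) j]/= scaler0 addr0.
Qed.

Let axis_bounded i (v : P) : `|dfwith (0 : P) i (v i) : P| <= 1 * `|v|.
Proof.
rewrite mul1r; apply: bprod_norm_le => // j.
have [<-|ij] := eqVneq i j; first by rewrite dfwithin; exact: le_bprod_norm.
by rewrite dfwithout// normr0.
Qed.

Definition baxis i : clin P P :=
  clin_bounded (@axis_linear i) (@axis_bounded i).

End NormedProduct.

(* Frechet C^k on an open set U: the successive derivatives take values in
   iterated spaces clin V (clin V _), with the operator norm. *)
Fixpoint Ck_on {R : realType} {V : normedModType R} (k : nat)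
    (W : normedModType R) (U : set V) (f : V -> W) : Prop :=
  if k is k'.+1 then
    (forall x, U x -> differentiable f x) /\ Ck_on k' U (fdiff f)
  else forall x, U x -> {for x, continuous f}.

Definition smooth_on {R : realType} {V W : normedModType R} (U : set V)
  (f : V -> W) : Prop := forall k, Ck_on k U f.

Record chart {R : realType} (E : normedModType R) (M : topologicalType) := Chart {
  chart_dom : set M;
  chart_cod : set E;
  chart_fun :> M -> E;
  chart_inv : E -> M;
  chart_dom_open : open chart_dom;
  chart_cod_open : open chart_cod;
  chart_funP : forall p, chart_dom p -> chart_cod (chart_fun p);
  chart_invP : forall x, chart_cod x -> chart_dom (chart_inv x);
  chart_funK : forall p, chart_dom p -> chart_inv (chart_fun p) = p;
  chart_invK : forall x, chart_cod x -> chart_fun (chart_inv x) = x;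
  chart_fun_continuous :
    forall p, chart_dom p -> {for p, continuous chart_fun};
  chart_inv_continuous :
    forall x, chart_cod x -> {for x, continuous chart_inv} }.

Definition transition {R : realType} {E : normedModType R} {M : topologicalType}
  (c c' : chart E M) : E -> E := c' \o chart_inv c.

Definition transition_dom {R : realType} {E : normedModType R}
  {M : topologicalType} (c c' : chart E M) : set E :=
  chart_cod c `&` chart_inv c @^-1` chart_dom c'.

Record banach_manifold {R : realType} (E : completeNormedModType R)
    (M : topologicalType) := BanachManifold {
  atlas : set (chart E M);
  atlas_cover : forall p, exists c, atlas c /\ chart_dom c p;
  atlas_smooth : forall c c', atlas c -> atlas c' ->
    smooth_on (transition_dom c c') (transition c c');
  manifold_hausdorff : hausdorff_space M;
  manifold_second_countable : @second_countable M }.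

Section ProductChart.
Context {R : realType} {I : finType} {E : I -> normedModType R}.
Context {M : I -> topologicalType} (c : forall i, chart (E i) (M i)).

Let dom : set (prod_topology M) := [set p | forall i, chart_dom (c i) (p i)].
Let cod : set (bprod E) := [set x | forall i, chart_cod (c i) (x i)].
Let fn (p : prod_topology M) : bprod E := fun i => c i (p i).
Let inv (x : bprod E) : prod_topology M := fun i => chart_inv (c i) (x i).

Let dom_open : open dom.
Proof.
rewrite openE => p dp.
change (\forall q \near p, forall i, chart_dom (c i) (q i)).
apply: (@filter_forall _ I (fun i q => chart_dom (c i) (q i)) _ (nbhs_filter p)) => i.
have /(@proj_continuous I M i p) : nbhs (p i) (chart_dom (c i)).
  by apply: open_nbhs_nbhs; split; [exact: chart_dom_open|exact: dp].
by [].
Qed.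

Let cod_open : open cod.
Proof.
rewrite openE => x cx.
change (\forall y \near x, forall i, chart_cod (c i) (y i)).
apply: (@filter_forall _ I (fun i y => chart_cod (c i) (y i)) _ (nbhs_filter x)) => i.
have /(@clin_continuous _ _ _ (bproj E i) x) : nbhs (x i) (chart_cod (c i)).
  by apply: open_nbhs_nbhs; split; [exact: chart_cod_open|exact: cx].
by [].
Qed.

Let funP p : dom p -> cod (fn p).
Proof. by move=> dp i; apply: chart_funP; exact: dp. Qed.
Let invP x : cod x -> dom (inv x).
Proof. by move=> cx i; apply: chart_invP; exact: cx. Qed.
Let funK p : dom p -> inv (fn p) = p.
Proof.
by move=> dp; apply: functional_extensionality_dep => i; apply: chart_funK; exact: dp.
Qed.
Let invK x : cod x -> fn (inv x) = x.
Proof. by move=> cx; apply: bprodP => i; apply: chart_invK; exact: cx. Qed.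

Let fn_continuous p : dom p -> {for p, continuous fn}.
Proof.
move=> dp; apply: (@bprod_cvg _ _ _ _ _ _ _ (nbhs_filter p)) => i.
change (continuous_at p (c i \o @proj I M i)).
apply: continuous_comp; first exact: (@proj_continuous I M i).
by apply: chart_fun_continuous; exact: dp.
Qed.

Let inv_continuous x : cod x -> {for x, continuous inv}.
Proof.
move=> cx; apply/(cvg_sup _ _ (fmap_filter _ (nbhs_filter x))) => i A [B [[C oC <-] Cx]] /filterS; apply.
have /(_ C) : {for x, continuous (chart_inv (c i) \o bproj E i)}.
  apply: continuous_comp; first exact: clin_continuous.
  by apply: chart_inv_continuous; exact: cx.
by apply; exact: open_nbhs_nbhs.
Qed.

Definition prod_chart : chart (bprod E) (prod_topology M) :=
  Chart dom_open cod_open funP invP funK invK fn_continuous inv_continuous.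

End ProductChart.

Lemma near_diff {R : realType} {V W : normedModType R} (f g : V -> W) (x : V) :
  differentiable g x -> (\forall y \near x, f y = g y) ->
  'd f x = 'd g x :> (V -> W).
Proof.
move=> dg fg; have fgx : f x = g x by exact: nbhs_singleton fg.
apply: diff_unique; first exact: diff_continuous.
have /eqaddoP gP := diff_locally dg; apply/eqaddoP => e e0.
have fg0 : \forall h \near 0, f (h + x) = g (h + x).
  by move: fg; rewrite (near_shift 0); apply: filterS => h /=; rewrite subr0.
near=> h.
have <- : (g \o shift x - (cst (g x) + 'd g x)) h =
          (f \o shift x - (cst (f x) + 'd g x)) h.
  have fgh : f (h + x) = g (h + x) by near: h.
  by rewrite /= fgx; congr (_ - _); rewrite /= fgh.
by near: h; exact: gP.
Unshelve. all: by end_near. Qed.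

Section Tangent.
Context {R : realType} {E : completeNormedModType R} {M : topologicalType}.
Context (S : banach_manifold E M) (p : M).

Definition charts_at : Type := {c : chart E M | atlas S c /\ chart_dom c p}.

Definition chart_at : charts_at := cid (atlas_cover S p).

(* A tangent vector at p is encoded by all of its chart representatives: the
   class of (c, nu), where (c, nu) ~ (c', nu') iff nu' = D(c' o c^-1)(c p) nu,
   becomes the function mapping each chart c at p to nu. *)
Definition tangent_pred : {pred charts_at -> E} :=
  [pred v | `[< forall c c' : charts_at,
    v c' = 'd (transition (sval c) (sval c')) (sval c p) (v c) >]].

Lemma tangent_submod_closed : submod_closed tangent_pred.
Proof.
split=> [|a v w]; rewrite !inE; first by move=> c c'; rewrite linear0.
move=> vP wP c c'.
change (a *: v c' + w c' =
  'd (transition (sval c) (sval c')) (sval c p) (a *: v c + w c)).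
by rewrite linearP -vP -wP.
Qed.

HB.instance Definition _ := GRing.isSubmodClosed.Build R (charts_at -> E)
  tangent_pred tangent_submod_closed.

Record tangent := Tangent {
  tangent_rep :> charts_at -> E;
  tangentP : tangent_rep \in tangent_pred }.

HB.instance Definition _ := [isSub for tangent_rep].
HB.instance Definition _ := [Choice of tangent by <:].
HB.instance Definition _ := [SubChoice_isSubLmodule of tangent by <:].

(* The norm depends on the choice of chart_at; the topology it induces does
   not, and only this topology matters for continuous linear functionals. *)
Definition tangent_norm (v : tangent) : R := `|v chart_at|.

Let normD (v w : tangent) :
  tangent_norm (v + w) <= tangent_norm v + tangent_norm w.
Proof. exact: ler_normD. Qed.

Let normZ (a : R) (v : tangent) :
  tangent_norm (a *: v) = `|a| * tangent_norm v.
Proof. exact: normrZ. Qed.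

Let norm0_eq0 (v : tangent) : tangent_norm v = 0 -> v = 0.
Proof.
move=> /eqP; rewrite normr_eq0 => /eqP v0; apply/val_inj/funext => c.
have := tangentP v; rewrite inE => /(_ chart_at c) /= ->.
by rewrite v0 linear0.
Qed.

HB.instance Definition _ :=
  Lmodule_isNormed.Build R tangent normD normZ norm0_eq0.

(* In every chart, all vectors of E represent a tangent vector. *)
Lemma tangent_rep_surj (c : charts_at) (nu : E) : exists v : tangent, v c = nu.
Proof.
pose tr (a b : charts_at) := transition (sval a) (sval b).
have trd (a b : charts_at) : transition_dom (sval a) (sval b) (sval a p).
  case: a b => [a [Aa ap]] [b [Ab bp]]; split; first exact: chart_funP.
  by rewrite /preimage /mkset /= chart_funK.
have trD (a b : charts_at) : differentiable (tr a b) (sval a p).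
  have [Aa _] := svalP a; have [Ab _] := svalP b.
  by have [] := atlas_smooth Aa Ab 1%N; move=> /(_ _ (trd a b)).
have trE (a b : charts_at) : tr a b (sval a p) = sval b p.
  by have [_ ap] := svalP a; rewrite /tr /transition /= chart_funK.
pose v (a : charts_at) := 'd (tr c a) (sval c p) nu.
have vP : v \in tangent_pred.
  rewrite inE => a b; rewrite /v -[LHS]/('d (tr c b) _ nu).
  have dab : differentiable (tr a b) (tr c a (sval c p)) by rewrite trE; exact: trD.
  have -> : 'd (tr c b) (sval c p) = 'd (tr a b \o tr c a) (sval c p) :> (E -> E).
    apply: near_diff.
      exact: differentiable_comp (trD c a) dab.
    have [_ cp] := svalP c; have [_ ap] := svalP a.
    have oa : nbhs p (chart_dom (sval a)).
      by apply: open_nbhs_nbhs; split; [exact: chart_dom_open|].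
    have := chart_inv_continuous (chart_funP cp).
    rewrite /prop_for /continuous_at chart_funK// => /(_ _ oa) cva.
    apply: (@filterS _ _ (nbhs_filter (sval c p)) _ _ _ cva) => x xa.
    by rewrite /tr /transition /= chart_funK.
  by rewrite (diff_comp (trD c a) dab) /= trE.
exists (Tangent vP); rewrite /= /v.
have -> : 'd (tr c c) (sval c p) = 'd id (sval c p) :> (E -> E).
  apply: near_diff; first by apply: ex_diff.
  have [_ cp] := svalP c.
  have cc := open_nbhs_nbhs (conj (chart_cod_open (sval c)) (chart_funP cp)).
  apply: (@filterS _ _ (nbhs_filter (sval c p)) _ _ _ cc) => x xc.
  by rewrite /tr /transition /= chart_invK.
by rewrite diff_val.
Qed.

End Tangent.

Section Game.
Context {R : realType} {n : nat} {E : 'I_n -> completeNormedModType R}.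
Context {M : 'I_n -> topologicalType} (S : forall i, banach_manifold (E i) (M i)).
Local Notation PM := (prod_topology M).

Definition Ck_manifold (k : nat) (f : PM -> R) : Prop :=
  forall c : (forall i, chart (E i) (M i)), (forall i, atlas (S i) (c i)) ->
    Ck_on k (chart_cod (prod_chart c)) (f \o chart_inv (prod_chart c)).

(* The tangent space of the product manifold, through the canonical splitting
   T_u M = T_(u 0) (M 0) * ... * T_(u n-1) (M n-1). *)
Definition prod_tangent (u : PM) : normedModType R :=
  bprod (fun i => tangent (S i) (u i)).

Definition cotangent (u : PM) : normedModType R := clin (prod_tangent u) R.

Definition prod_chart_at (u : PM) : chart (bprod E) PM :=
  prod_chart (fun i => sval (chart_at (S i) (u i))).

Lemma prod_tangent_rep_linear (u : PM) :
  linear (fun v : prod_tangent u =>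
    (fun i => v i (chart_at (S i) (u i))) : bprod E).
Proof. by []. Qed.

Lemma prod_tangent_rep_bounded (u : PM) (v : prod_tangent u) :
  `|(fun i => v i (chart_at (S i) (u i))) : bprod E| <= 1 * `|v|.
Proof. by rewrite mul1r. Qed.

Definition prod_tangent_rep (u : PM) : clin (prod_tangent u) (bprod E) :=
  clin_bounded (@prod_tangent_rep_linear u) (@prod_tangent_rep_bounded u).

(* df(u) v = D(f o c^-1)(c u) v_c, where v_c represents v in the chart c. *)
Definition differential (f : PM -> R) (u : PM) : cotangent u :=
  clin_comp (fdiff (f \o chart_inv (prod_chart_at u)) (prod_chart_at u u))
    (prod_tangent_rep u).

(* Under the splitting, xi corresponds to (xi_0, ..., xi_(n-1)) and psi i xi
   to (0, ..., xi_i, ..., 0). *)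
Definition psi (i : 'I_n) (u : PM) (xi : cotangent u) : cotangent u :=
  clin_comp xi (baxis _ i).

Definition game_form (f : 'I_n -> PM -> R) (u : PM) : cotangent u :=
  \sum_i psi i (differential (f i) u).

Definition local_nash (f : 'I_n -> PM -> R) (u : PM) : Prop :=
  exists W : forall i, set (M i),
    (forall i, open (W i) /\ W i (u i)) /\
    forall i (v : M i), (W i `\ u i) v -> f i u <= f i (dfwith u i v).

End Game.

Section Hessian.
Context {R : realType} {E : completeNormedModType R} {M : topologicalType}.
Context (S : banach_manifold E M).

(* The representatives, in all charts at p, of the Hessian of g at p.  They
   define a single bilinear form on the tangent space only when p is a critical
   point of g. *)
Definition hessian (g : M -> R) (p : M) (c : charts_at S p) :
    clin E (clin E R) :=
  fdiff (fdiff (g \o chart_inv (sval c))) (sval c p).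

(* Whether this holds does not depend on the chart at a critical point. *)
Definition pos_semidef (p : M) (H : charts_at S p -> clin E (clin E R)) : Prop :=
  forall c, exists2 alpha : R, 0 <= alpha &
    forall nu : E, H c nu nu >= alpha * `|nu| ^+ 2.

End Hessian.

Arguments hessian {R E M} S g p c.
Arguments pos_semidef {R E M S p} H.

Definition second_partial {R : realType} {n : nat}
    {E : 'I_n -> completeNormedModType R} {M : 'I_n -> topologicalType}
    (S : forall i, banach_manifold (E i) (M i)) (i : 'I_n)
    (f : prod_topology M -> R) (u : prod_topology M) :
    charts_at (S i) (u i) -> clin (E i) (clin (E i) R) :=
  hessian (S i) (fun mu : M i => f (dfwith u i mu)) (u i).

Arguments second_partial {R n E M} S i f u c.

(* Main.v *)
Require Import Defs.
From HB Require Import structures.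
From mathcomp Require Import all_boot all_order all_algebra.
From mathcomp Require Import mathcomp_extra boolp classical_sets functions reals.
From mathcomp Require Import topology normedtype derive.

Set Implicit Arguments.
Unset Strict Implicit.
Unset Printing Implicit Defensive.
Import Order.TTheory GRing.Theory Num.Theory.
Import numFieldNormedType.Exports.
Local Open Scope classical_set_scope.
Local Open Scope ring_scope.

(** Let u be a local Nash equilibrium, fix a player i, and read f i in a
    product chart around u as a C^2 function F on an open set of the product
    of the Banach spaces E j, with x the image of u.  Moving along a line
    x + t w, with w in the factor E i, changes only the strategy of player i,
    so the equilibrium condition says that t |-> F (x + t w) has a local
    minimum at t = 0 (nash_local_min_chart).  The second derivative test for
    functions of one real variable then gives DF(x) w = 0 and
    D^2F(x) (w, w) >= 0 (fdiff_local_min_line).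

    The first relation is the theorem's first half, because the value of the
    game form on a tangent vector v is the sum over i of DF_i(x) applied to
    the i-th component of v (game_formE).

    For the second half, the Hessian of mu |-> f i (u with mu at i) is that of
    the restriction of F to an affine copy of E i through x, and by the chain
    rule the second derivative of a composite with an affine map y |-> b + A y
    is D^2F (A _, A _) (fdiff2_affine).  Hence it is nonnegative on the
    diagonal, and alpha = 0 witnesses semi-definiteness. *)

(** * The second derivative test on the real line *)

Section LocalMin.
Context {R : realType}.

(** If a < 0, then df, which vanishes at c, is negative just to the right of c,
    so by the mean value theorem f takes values below f c there. *)
Lemma second_derivative_test (f df : R -> R) (c a : R) :
  (\forall t \near c, is_derive (t : R) 1 f (df t)) -> is_derive c 1 df a ->
  (\forall t \near c, f c <= f t) -> df c = 0 /\ 0 <= a.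
Proof.
move=> fdf dfa fmin.
have [e /= e0 ce] : exists2 e : R, 0 < e & forall t : R, `|c - t| < e ->
    is_derive t 1 f (df t) /\ f c <= f t.
  have : \forall t \near c, is_derive (t : R) 1 f (df t) /\ f c <= f t.
    by near=> t; split; near: t.
  by move=> /nbhs_ballP[e e0 ce]; exists e.
have ceI t : t \in `]c - e, c + e[%R -> `|c - t| < e.
  by rewrite in_itv/= distrC ltr_distl.
have dfc0 : df c = 0.
  have [dc _] : is_derive c 1 f (df c) /\ f c <= f c.
    by apply: ce; rewrite subrr normr0.
  have d0 : is_derive c 1 f 0.
    apply: (@derive1_at_min _ f (c - e) (c + e)).
    - by rewrite lerBlDr -addrA lerDl addr_ge0// ltW.
    - by move=> t /ceI/ce[[]].
    - by rewrite in_itv/= gtrBl ltrDl e0.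
    - by move=> t /ceI/ce[].
  by rewrite -(@derive_val _ _ _ _ _ _ _ dc) derive_val.
split=> //; rewrite leNgt; apply/negP => a0.
(* The difference quotients of df at c tend to a < 0, and df c = 0. *)
have dfneg : \forall h \near 0^'+, df (h + c) < 0.
  have qa : h^-1 *: (df (h + c) - df c) @[h --> 0^'] --> a.
    have := @ex_derive _ _ _ _ _ _ _ dfa.
    move=> /cvg_ex[l ql].
    have := @derive_val _ _ _ _ _ _ _ dfa; rewrite /derive.
    rewrite (cvg_lim _ ql)// => <-; move: ql.
    by apply: cvg_trans; apply: near_eq_cvg; near=> h; rewrite /= [h%:A]mulr1.
  have qn : \forall h \near 0^', h^-1 *: (df (h + c) - df c) < 0.
    exact: (cvgr_lt _ qa).
  near=> h.
  have h0 : 0 < h by near: h; exact: nbhs_right_gt.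
  have : h^-1 *: (df (h + c) - df c) < 0.
    near: h; move: qn; rewrite !near_withinE; apply: filterS => h hq h0.
    by apply: hq; rewrite gt_eqF.
  by rewrite dfc0 subr0 pmulr_rlt0// invr_gt0.
move: dfneg; rewrite near_withinE => /nbhs_ballP[d /= d0 dd].
(* On ]c, c + r] the function f is at least f c and df is negative. *)
pose r := Num.min d e / 2.
have r0 : 0 < r by rewrite divr_gt0// lt_min d0.
have rde : r < Num.min d e by rewrite ltr_pdivrMr// ltr_pMr ?lt_min ?d0// ltr1n.
have [rd re] : r < d /\ r < e by apply/andP; rewrite -lt_min.
have near_c t : c <= t -> t <= c + r -> `|c - t| < e.
  move=> ct tr; rewrite distrC ger0_norm ?subr_ge0//.
  by rewrite ltrBlDl (le_lt_trans tr)// ltrD2l.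
have [] := @MVT R f df c (c + r).
- by rewrite ltrDl.
- move=> t; rewrite in_itv/= => /andP[/ltW ct /ltW tr].
  by case: (ce t (near_c t ct tr)).
- apply: derivable_within_continuous => t; rewrite in_itv/= => /andP[ct tr].
  by case: (ce t (near_c t ct tr)) => -[].
move=> s; rewrite in_itv/= => /andP[cs sr] fs.
have : f c <= f (c + r).
  by case: (ce (c + r)) => //; apply: near_c; rewrite // lerDl ltW.
rewrite -subr_ge0 fs addrAC subrr add0r pmulr_lge0// leNgt => /negP; apply.
have := dd (s - c); rewrite subrK; apply; rewrite ?subr_gt0//.
by rewrite /ball/= sub0r normrN gtr0_norm ?subr_gt0// ltrBlDl (lt_trans sr)// ltrD2l.
Unshelve. all: by end_near. Qed.

End LocalMin.

(** * Calculus of continuous linear maps *)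

Section Clin.
Context {R : realType} {U V W : normedModType R}.

Lemma clin_is_diff (L : clin V W) x : is_diff x L L.
Proof.
apply: DiffDef; first exact/linear_differentiable/clin_continuous.
by rewrite diff_lin//; exact: clin_continuous.
Qed.

Let eval_linear (v : V) : linear (fun L : clin V W => L v).
Proof. by []. Qed.
Let eval_bounded (v : V) (L : clin V W) : `|L v| <= `|v| * `|L|.
Proof. by rewrite mulrC; exact: le_op_norm. Qed.

(** Continuity of this map is what lets a derivative of t |-> 'd F (l t) v be
    computed from the differential of fdiff F. *)
Definition clin_eval (v : V) : clin (clin V W) W :=
  clin_bounded (eval_linear v) (eval_bounded v).

Let precomp_linear (A : clin U V) :
  linear (fun L : clin V W => clin_comp L A).
Proof. by move=> a L K; apply: clinE. Qed.
Let precomp_bounded (A : clin U V) (L : clin V W) :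
  `|clin_comp L A| <= `|A| * `|L|.
Proof.
apply: op_norm_le => [|x]; first exact: mulr_ge0.
rewrite [`|A| * _]mulrC -mulrA (le_trans (le_op_norm L (A x)))//.
by apply: ler_wpM2l; [exact: op_norm_ge0|exact: (le_op_norm A x)].
Qed.

(** Through this map the chain rule fdiff (F \o A) = fdiff F _ \o A is itself
    the composite of fdiff F with a continuous linear map, hence can be
    differentiated again. *)
Definition clin_precomp (A : clin U V) : clin (clin V W) (clin U W) :=
  clin_bounded (precomp_linear A) (precomp_bounded A).

End Clin.

Section Affine.
Context {R : realType} {U V W : normedModType R}.
Variables (A : clin U V) (b : V).

Lemma affine_is_diff x : is_diff x (fun y => b + A y) A.
Proof.
have dA := clin_is_diff A x.
have dS : is_diff x (cst b + (A : U -> V)) (0 + (A : U -> V)) by exact: is_diffD.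
by move: dS; rewrite add0r.
Qed.

Lemma fdiff_affine (F : V -> W) x : differentiable F (b + A x) ->
  fdiff (fun y => F (b + A y)) x = clin_comp (fdiff F (b + A x)) A.
Proof.
move=> dF; have dA := affine_is_diff x; apply: clinE => v.
rewrite /= -[LHS]/('d (F \o (fun y => b + A y)) x v) diff_comp//=.
by rewrite diff_val.
Qed.

(** Near x, the differential of the composite is y |-> fdiff F (b + A y) \o A by
    fdiff_affine; the affine map contributes no second-order term. *)
Lemma fdiff2_affine (F : V -> W) x v w :
  (\forall y \near b + A x, differentiable F y) ->
  differentiable (fdiff F) (b + A x) ->
  fdiff (fdiff (fun y => F (b + A y))) x v w =
  fdiff (fdiff F) (b + A x) (A v) (A w).
Proof.
move=> dF d2F; have dA := affine_is_diff x.
have dF' : differentiable (fdiff F \o (fun y => b + A y)) x.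
  by apply: differentiable_comp => //; exact: ex_diff.
pose P : clin (clin V W) (clin U W) := clin_precomp A.
have dP y : is_diff y P P by exact: clin_is_diff.
rewrite -[LHS]/('d (fdiff (fun y => F (b + A y))) x v w).
rewrite (@near_diff _ _ _ _ (P \o (fdiff F \o (fun y => b + A y)))).
- rewrite diff_comp// (@diff_val _ _ _ _ _ _ _ (dP _)).
  by rewrite diff_comp// (@diff_val _ _ _ _ _ _ _ dA).
- exact: differentiable_comp.
- have : {for x, continuous (fun y => b + A y)}.
    by apply: differentiable_continuous; exact: ex_diff.
  move=> /(_ _ dF); apply: (@filterS _ _ (nbhs_filter x)) => y dFy.
  by rewrite fdiff_affine.
Qed.

End Affine.

(** * Local minima along lines *)

Section LocalMinLine.
Context {R : realType} {V : normedModType R}.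

(** The first and second derivatives of t |-> F (x + t v) at 0 are DF(x) v and
    D^2F(x) (v, v), so the one-variable test applies.  Minimality is asked in
    the direction v only, since at a Nash equilibrium the cost of a player is
    minimal only among that player's own moves. *)
Lemma fdiff_local_min_line (F : V -> R) (x v : V) :
  (\forall y \near x, differentiable F y) -> differentiable (fdiff F) x ->
  (\forall t \near (0 : R), F x <= F (x + t *: v)) ->
  fdiff F x v = 0 /\ 0 <= fdiff (fdiff F) x v v.
Proof.
move=> dF d2F minF; pose l (t : R) := x + t *: v.
have dl t : is_diff t l ( *:%R^~ v : R -> V).
  have dS : is_diff t (cst x + ( *:%R^~ v : R -> V)) (0 + ( *:%R^~ v : R -> V)).
    exact: is_diffD.
  by move: dS; rewrite add0r.
have l0 : l 0 = x by rewrite /l scale0r addr0.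
have dline (W : normedModType R) (G : V -> W) t : differentiable G (l t) ->
    is_derive (t : R) 1 (G \o l) ('d G (l t) v).
  move=> dG; have dGl : differentiable (G \o l) t.
    by apply: differentiable_comp => //; exact: ex_diff.
  apply: DeriveDef; first exact: diff_derivable.
  rewrite deriveE// diff_comp//.
  by rewrite diff_val /= scale1r.
pose ev : clin (clin V R) R := clin_eval v.
have [] := @second_derivative_test R (F \o l) (fun t => fdiff F (l t) v) 0
  (fdiff (fdiff F) x v v).
- have : {for 0, continuous l} by apply: differentiable_continuous; exact: ex_diff.
  rewrite /prop_for /continuous_at l0 => /(_ _ dF).
  by apply: (@filterS _ _ (nbhs_filter (0 : R))) => t; exact: dline.
- have dev := clin_is_diff ev (fdiff F x).
  have /dline : differentiable (ev \o fdiff F) (l 0).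
    by rewrite l0; apply: differentiable_comp => //; exact: ex_diff.
  by rewrite diff_comp ?l0// (@diff_val _ _ _ _ _ _ _ dev).
- by apply: filterS minF => t; rewrite /= l0.
- by rewrite l0.
Qed.

End LocalMinLine.

(** * Inclusion of a factor in a product of normed spaces *)

Section Inclusion.
Context {R : realType} {I : finType} (E : I -> normedModType R).

Let incl_linear i : linear (fun w : E i => dfwith (0 : bprod E) i w : bprod E).
Proof.
move=> a v w; apply: bprodP => j.
rewrite -[RHS]/(a *: dfwith (0 : bprod E) i v j + dfwith (0 : bprod E) i w j).
have [<-|ij] := eqVneq i j; first by rewrite !dfwithin.
by rewrite !dfwithout// -[LHS]/(0 : E j) -[X in a *: X + X]/(0 : E j) scaler0 addr0.
Qed.

Let incl_bounded i (w : E i) : `|dfwith (0 : bprod E) i w : bprod E| <= 1 * `|w|.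
Proof.
rewrite mul1r; apply: bprod_norm_le => // j.
have [<-|ij] := eqVneq i j; first by rewrite dfwithin.
by rewrite dfwithout// normr0.
Qed.

Definition bincl i : clin (E i) (bprod E) :=
  clin_bounded (@incl_linear i) (@incl_bounded i).

Lemma bincl_same i w : bincl i w i = w.
Proof. exact: dfwithin. Qed.

Lemma bincl_other i j w : i != j -> bincl i w j = 0.
Proof. exact: dfwithout. Qed.

End Inclusion.

(** * Local Nash equilibria in product charts *)

Lemma dfwith_id {I : eqType} {T : I -> Type} (f : forall i, T i) i :
  dfwith f i (f i) = f.
Proof.
by apply: functional_extensionality_dep => j; case: dfwithP.
Qed.

Section Nash.
Context {R : realType} {n : nat} {E : 'I_n -> completeNormedModType R}.
Context {M : 'I_n -> topologicalType} (S : forall i, banach_manifold (E i) (M i)).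
Variables (f : 'I_n -> prod_topology M -> R) (u : prod_topology M).
Variable c : forall j, charts_at (S j) (u j).

Local Notation pc := (prod_chart (fun j => sval (c j))).

Let at_u : chart_dom pc u.
Proof. by move=> j; case: (svalP (c j)). Qed.

(** In a product chart, the strategies of player i against u form an affine
    copy of E i: the image of u with its i-th coordinate set to 0, plus E i.
    This is the affine map to which fdiff2_affine is applied. *)
Lemma prod_chart_inv_slice i (nu : E i) :
  chart_inv pc (pc u - bincl E i (pc u i) + bincl E i nu) =
  dfwith u i (chart_inv (sval (c i)) nu).
Proof.
apply: functional_extensionality_dep => j.
rewrite -[LHS]/(chart_inv (sval (c j))
  (pc u j - bincl E i (pc u i) j + bincl E i nu j)).
have [<-|ij] := eqVneq i j.
  by rewrite !bincl_same subrr add0r dfwithin.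
by rewrite !bincl_other// subr0 addr0 dfwithout//; apply: chart_funK; exact: at_u.
Qed.

(** The point of the chart with coordinates pc u + t w is u with only the i-th
    strategy changed; by continuity of the inverse chart this strategy is in
    the neighbourhood W i of the equilibrium for small t. *)
Lemma nash_local_min_chart i (w : E i) : local_nash f u ->
  \forall t \near (0 : R),
    (f i \o chart_inv pc) (pc u) <= (f i \o chart_inv pc) (pc u + t *: bincl E i w).
Proof.
move=> [W [oW nashW]]; have [oWi Wu] := oW i.
have cu := at_u i.
pose l (t : R) := sval (c i) (u i) + t *: w.
have lc : {for 0, continuous (chart_inv (sval (c i)) \o l)}.
  apply: continuous_comp.
    apply: cvgD; first exact: cvg_cst.
    exact: scalel_continuous.
  by rewrite /l scale0r addr0; apply: chart_inv_continuous; exact: chart_funP.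
have nW : nbhs ((chart_inv (sval (c i)) \o l) 0) (W i).
  apply: open_nbhs_nbhs; split => //.
  by rewrite /= /l scale0r addr0 chart_funK.
apply: (@filterS _ _ (nbhs_filter (0 : R)) _ _ _ (lc _ nW)) => t Wt.
have -> : pc u + t *: bincl E i w = pc u - bincl E i (pc u i) + bincl E i (l t).
  by rewrite [bincl E i (l t)]linearD linearZ addrA subrK.
rewrite /comp prod_chart_inv_slice (chart_funK at_u).
(* The equilibrium condition compares with strategies other than u i only. *)
have [<-|neq] := pselect (u i = chart_inv (sval (c i)) (l t)).
  by rewrite dfwith_id.
by apply: nashW; split => // /esym.
Qed.

Hypothesis f2 : forall j, Ck_manifold S 2 (f j).
Hypothesis nash : local_nash f u.

Let f2_chart i :
  (\forall x \near pc u, differentiable (f i \o chart_inv pc) x) /\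
  differentiable (fdiff (f i \o chart_inv pc)) (pc u).
Proof.
have [df [d2f _]] := f2 i (fun j => (svalP (c j)).1).
split; last exact/d2f/chart_funP.
have := open_nbhs_nbhs (conj (chart_cod_open pc) (chart_funP at_u)).
exact: filterS.
Qed.

Lemma nash_partial_eq0 i (w : E i) :
  fdiff (f i \o chart_inv pc) (pc u) (bincl E i w) = 0.
Proof.
have [df d2f] := f2_chart i.
by have [] := fdiff_local_min_line df d2f (nash_local_min_chart w nash).
Qed.

Lemma nash_second_partial_ge0 i (nu : E i) :
  0 <= second_partial S i (f i) u (c i) nu nu.
Proof.
have [df d2f] := f2_chart i.
have := (fdiff_local_min_line df d2f (nash_local_min_chart nu nash)).2.
have pcE : pc u - bincl E i (pc u i) + bincl E i (pc u i) = pc u by rewrite subrK.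
have := @fdiff2_affine _ _ _ _ (bincl E i) (pc u - bincl E i (pc u i))
  (f i \o chart_inv pc) (pc u i) nu nu.
rewrite pcE => /(_ df d2f) <-.
rewrite /second_partial /hessian.
suff -> : (fun mu => f i (dfwith u i mu)) \o chart_inv (sval (c i)) =
  (fun y => (f i \o chart_inv pc) (pc u - bincl E i (pc u i) + bincl E i y)) by [].
apply/funext => y; rewrite /comp.
by rewrite -prod_chart_inv_slice.
Qed.

End Nash.

(** Taking the i-th component of a tangent vector commutes with representing it
    in a product chart, so psi i turns into the inclusion of the factor E i. *)
Lemma game_formE {R : realType} {n : nat} {E : 'I_n -> completeNormedModType R}
    {M : 'I_n -> topologicalType} (S : forall i, banach_manifold (E i) (M i))
    (f : 'I_n -> prod_topology M -> R) (u : prod_topology M)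
    (v : prod_tangent S u) :
  game_form S f u v =
  \sum_i fdiff (f i \o chart_inv (prod_chart_at S u)) (prod_chart_at S u u)
    (bincl E i (v i (chart_at (S i) (u i)))).
Proof.
rewrite -[LHS]/(clin_eval v (game_form S f u)) linear_sum; apply: eq_bigr => i _.
rewrite -[LHS]/(fdiff _ _ (prod_tangent_rep S u (baxis _ i v))).
congr (fdiff _ _ _); apply: bprodP => j.
rewrite -[LHS]/(dfwith (0 : prod_tangent S u) i (v i) j (chart_at (S j) (u j))).
have [<-|ij] := eqVneq i j; first by rewrite bincl_same dfwithin.
by rewrite bincl_other// dfwithout.
Qed.

Theorem proposition1 (R : realType) (n : nat)
    (E : 'I_n -> completeNormedModType R) (M : 'I_n -> topologicalType)
    (S : forall i, banach_manifold (E i) (M i))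
    (f : 'I_n -> prod_topology M -> R) (u : prod_topology M) :
  (forall j, Ck_manifold S 2 (f j)) ->
  local_nash f u ->
  game_form S f u = 0 /\
  forall i, pos_semidef (second_partial S i (f i) u).
Proof.
move=> f2 nash; split.
  apply: clinE => v; rewrite game_formE big1// => i _.
  exact: (nash_partial_eq0 _ f2 nash).
move=> i c; exists 0 => // nu; rewrite mul0r.
(* Any chart at u i is completed to a product chart by arbitrary other charts. *)
have := nash_second_partial_ge0
  (dfwith (fun j => chart_at (S j) (u j)) i c) f2 nash nu.
by rewrite dfwithin.
Qed.
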